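(* Let $N\ge 1$, let $A$ and $X$ be $N\times N$ (real or complex) matrices, and let $k\ge 1$ be an integer. Then $$\operatorname{tr}\big((\operatorname{swirl}(A,X))^k\big)=2^k\operatorname{tr}\big((AX)^k\big).$$
   Context: For $N\times N$ matrices $A,X$, $\operatorname{swirl}(A,X)$ is the $2N\times 2N$ block matrix $$\operatorname{swirl}(A,X)=\begin{pmatrix} AX & A\\ XAX & XA\end{pmatrix}.$$ *)

(* Defs.v *)
From HB Require Import structures.
From mathcomp Require Import all_boot all_order all_algebra.

Set Implicit Arguments.
Unset Strict Implicit.
Unset Printing Implicit Defensive.

Import GRing.Theory Num.Theory.
Local Open Scope ring_scope.

Definition swirl (F : numFieldType) (N : nat) (A X : 'M[F]_N) : 'M[F]_(N + N) :=
  block_mx (A *m X)        A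
           (X *m A *m X)   (X *m A).

(* Main.v *)
(* The swirl factors as [U *m V] with [U = col_mx 1 X] and [V = row_mx (A X) A];
   by cyclicity of the trace its powers have the same traces as those of
   [V *m U = 2 A X]. *)
Require Import Defs.
From HB Require Import structures.
From mathcomp Require Import all_boot all_order all_algebra.

Set Implicit Arguments.
Unset Strict Implicit.
Unset Printing Implicit Defensive.

Import GRing.Theory Num.Theory.
Local Open Scope ring_scope.

Lemma exprS_mulmx (R : pzRingType) (m n : nat) (U : 'M[R]_(m, n))
    (V : 'M[R]_(n, m)) (k : nat) :
  (U *m V) ^+ k.+1 = U *m (V *m U) ^+ k *m V.
Proof.
elim: k => [|k IHk]; first by rewrite expr0 mulmx1.
by rewrite exprS IHk [in RHS]exprS -!mulmxE !mulmxA.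
Qed.

(** Peeling off the outer [U] and [V] lets cyclicity carry [U] to the end. The exponent is a
    successor because at 0 the traces are the sizes [m] and [n]. *)
Lemma mxtrace_expr_mulmxC (R : comPzRingType) (m n : nat) (U : 'M[R]_(m, n))
    (V : 'M[R]_(n, m)) (k : nat) :
  \tr ((U *m V) ^+ k.+1) = \tr ((V *m U) ^+ k.+1).
Proof.
by rewrite exprS_mulmx -mulmxA mxtrace_mulC -mulmxA mulmxE -exprSr.
Qed.

Lemma swirl_factor (F : numFieldType) (N : nat) (A X : 'M[F]_N) :
  swirl A X = col_mx 1%:M X *m row_mx (A *m X) A.
Proof. by rewrite mul_col_row !mul1mx mulmxA. Qed.

(* A numFieldType covers both the real and the complex numbers. *)
Theorem theorem3p4 (F : numFieldType) (N : nat) (hN : (1 <= N)%N)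
    (A X : 'M[F]_N) (k : nat) (hk : (1 <= k)%N) :
  \tr (swirl A X ^+ k) = 2 ^+ k * \tr ((A *m X) ^+ k).
Proof.
case: N hN A X => // N _ A X; case: k hk => // k _.
rewrite swirl_factor mxtrace_expr_mulmxC mul_row_col mulmx1 -mulr2n.
(* Doubling is read as scaling by 2, so the power and then the trace release the factor 2^k. *)
by rewrite -scaler_nat exprZn mxtraceZ.
Qed.
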